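(* Let $(\mathfrak A,\leqslant,\wedge,\vee)$ be a finite lattice and let $\mathrm{JIrr}(\mathfrak A)$ be its set of join-irreducible elements, with the induced order. For every $a\in\mathfrak A$ there exists a unique antichain $\mathfrak B$ of $(\mathrm{JIrr}(\mathfrak A),\leqslant)$ that is maximal with respect to $\trianglelefteq$ among the antichains of $(\mathrm{JIrr}(\mathfrak A),\leqslant)$ that are join-decompositions of $a$.
   Context: An antichain of a poset is a subset of pairwise incomparable elements. For a poset $P$ and $\mathfrak B\subseteq P$, $\langle\mathfrak B\rangle_P$ is the order ideal (down-set) generated by $\mathfrak B$. For antichains $\mathfrak B,\mathfrak C$ of $P$, $\mathfrak B\trianglelefteq\mathfrak C$ means $\langle\mathfrak B\rangle_P\subseteq\langle\mathfrak C\rangle_P$; here $P=(\mathrm{JIrr}(\mathfrak A),\leqslant)$. A join-decomposition of $a\in\mathfrak A$ is a subset $\mathfrak B\subseteq\mathrm{JIrr}(\mathfrak A)$ with $a=\bigvee_{b\in\mathfrak B}b$ (the empty join being the least element $\widehat 0$ of $\mathfrak A$). An element $j\ne\widehat0$ is join-irreducible if $j=b\vee c$ implies $j=b$ or $j=c$. *)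

(* Defs.v *)
From HB Require Import structures.
From mathcomp Require Import all_boot all_order.

Set Implicit Arguments.
Unset Strict Implicit.
Unset Printing Implicit Defensive.

Import Order.TTheory.
Local Open Scope order_scope.

Section Antichains.
Variables (d : Order.disp_t) (P : finPOrderType d).
Implicit Types B C : {set P}.

Definition antichain B := {in B &, forall x y, x != y -> x >< y}.

Definition ideal B : {set P} := [set x | [exists b in B, x <= b]].

Definition trianglelefteq B C := ideal B \subset ideal C.

Definition maximal_antichain (Q : {set P} -> Prop) B :=
  [/\ antichain B, Q B &
      forall C, antichain C -> Q C -> trianglelefteq B C -> C = B].

End Antichains.

Section JoinIrreducibles.
(* A nonempty finite lattice is bounded, hence a [finTBLatticeType]; \bot is
   its least element. *)
Variables (d : Order.disp_t) (L : finTBLatticeType d).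

Definition join_irreducible (j : L) : bool :=
  (j != \bot) &&
  [forall b : L, forall c : L, (j == b `|` c) ==> ((j == b) || (j == c))].

Record JIrr : Type := MkJIrr { JIrr_val : L; _ : join_irreducible JIrr_val }.

HB.instance Definition _ := [isSub for JIrr_val].
HB.instance Definition _ := [Finite of JIrr by <:].
(* The order induced from L: x <= y unfolds to JIrr_val x <= JIrr_val y. *)
HB.instance Definition _ := [SubChoice_isSubPOrder of JIrr by <: with d].

(* An empty join is \bot. *)
Definition join_decomposition (a : L) (B : {set JIrr}) : Prop :=
  a = \join_(b in B) JIrr_val b.

End JoinIrreducibles.

(* Main.v *)
Require Import Defs.
From mathcomp Require Import all_boot all_order.

(** Take the maximal elements of the set of join-irreducibles below [a]. They
    generate the ideal of all join-irreducibles below [a], whose join is [a], so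
    they dominate every join-decomposition of [a]; and an antichain is
    determined by the ideal it generates. *)

Import Order.TTheory.
Local Open Scope order_scope.

Section FinitePoset.
Context {d : Order.disp_t} {P : finPOrderType d}.
Implicit Types (x y : P) (B C S : {set P}).

Definition lower_set x := [set z | z <= x].

(** The number of elements below a point thus serves as a strictly monotone rank, used both to pick
    maximal elements and to run an induction. *)
Lemma ltn_card_lower x y :
  x < y -> (#|lower_set x| < #|lower_set y|)%N.
Proof.
move=> ltxy; apply/proper_card/properP; split.
  by apply/subsetP=> z; rewrite !inE => /le_trans-> //; apply: ltW.
by exists y; rewrite !inE ?lexx // lt_geF.
Qed.

Lemma idealP B x : reflect (exists2 b, b \in B & x <= b) (x \in ideal B).
Proof. by rewrite inE; apply: (iffP exists_inP). Qed.

Lemma mem_ideal B x : x \in B -> x \in ideal B.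
Proof. by move=> Bx; apply/idealP; exists x. Qed.

Lemma antichain_le_eq B x y :
  antichain B -> x \in B -> y \in B -> x <= y -> x = y.
Proof.
move=> acB Bx By lexy; apply/eqP/negPn/negP=> /(acB x y Bx By).
by rewrite /Order.comparable lexy.
Qed.

(** A member [x] of [B] lies below some [y] in [C], which lies below some [z] in [B]; the antichain
    property forces [x = z], so [y] is squeezed onto [x]. *)
Lemma antichain_ideal_sub B C :
  antichain B -> ideal B = ideal C -> B \subset C.
Proof.
move=> acB eqBC; apply/subsetP=> x Bx.
have /idealP[y Cy lexy] : x \in ideal C by rewrite -eqBC mem_ideal.
have /idealP[z Bz leyz] : y \in ideal B by rewrite eqBC mem_ideal.
have eqxz := antichain_le_eq _ _ _ acB Bx Bz (le_trans lexy leyz).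
by rewrite (_ : x = y) //; apply/le_anti; rewrite lexy eqxz.
Qed.

Lemma antichain_ideal_inj B C :
  antichain B -> antichain C -> ideal B = ideal C -> B = C.
Proof.
by move=> acB acC eqBC; apply/eqP; rewrite eqEsubset !antichain_ideal_sub.
Qed.

Definition maxima S := [set x in S | [forall y in S, ~~ (x < y)]].

Lemma maxima_antichain S : antichain (maxima S).
Proof.
move=> x y /setIdP[Sx /forall_inP maxx] /setIdP[Sy /forall_inP maxy] neqxy.
apply/negP=> /orP[] le.
  by move: (maxx y Sy); rewrite lt_neqAle neqxy le.
by move: (maxy x Sx); rewrite lt_neqAle eq_sym neqxy le.
Qed.

Lemma maxima_above S x : x \in S -> exists2 y, y \in maxima S & x <= y.
Proof.
move=> Sx; pose above y := (y \in S) && (x <= y).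
have above_x : above x by rewrite /above Sx lexx.
(* Among the elements of [S] above [x], one of largest rank is maximal in [S]. *)
case: (arg_maxnP (fun y => #|lower_set y|) above_x).
move=> y /andP[Sy lexy] maxy; exists y => //.
rewrite inE Sy; apply/forall_inP=> z Sz; apply/negP=> ltyz.
have above_z : above z by rewrite /above Sz (le_trans lexy (ltW ltyz)).
by have := maxy z above_z; rewrite /= leqNgt ltn_card_lower.
Qed.

End FinitePoset.

Section FiniteLattice.
Context {d : Order.disp_t} {L : finTBLatticeType d}.
Implicit Types (a x : L) (j : JIrr L) (B : {set JIrr L}).

(** By strong induction on the rank of [a]: unless [a] is [\bot] or join-irreducible, it is the join
    of two strictly smaller elements. *)
Lemma le_join_irreducibles a x :
  (forall j, JIrr_val j <= a -> JIrr_val j <= x) -> a <= x.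
Proof.
have [n] := ubnP #|lower_set a|; elim: n a => // n IHn a; rewrite ltnS => card_a irr_le.
have [-> | a_neq0] := eqVneq a \bot; first exact: le0x.
have IH b : b <= a -> a != b -> b <= x.
  move=> leba neqab; apply: IHn => [|j lejb]; last exact/irr_le/(le_trans lejb).
  apply: leq_trans card_a; apply: ltn_card_lower.
  by rewrite lt_neqAle eq_sym neqab.
have [irr_a | ] := boolP (join_irreducible a).
  exact: (irr_le (MkJIrr irr_a) (lexx a)).
rewrite negb_and a_neq0 => /forallPn[b /forallPn[c]].
rewrite negb_imply negb_or => /and3P[/eqP def_a neqb neqc].
by rewrite def_a leUx !IH // def_a ?leUl ?leUr.
Qed.

Definition irr_below a : {set JIrr L} := [set j | JIrr_val j <= a].

(** [irr_below a] is already a down-set, and each of its members lies under a maximal one. *)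
Lemma ideal_maxima_irr_below a : ideal (maxima (irr_below a)) = irr_below a.
Proof.
apply/setP=> j; apply/idealP/idP=> [[k] | /maxima_above//].
rewrite !inE => /andP[leka _] lejk.
exact: (le_trans (lejk : JIrr_val j <= JIrr_val k) leka).
Qed.

Lemma ideal_decomposition_sub a B :
  join_decomposition a B -> ideal B \subset irr_below a.
Proof.
move=> def_a; apply/subsetP=> j /idealP[k Bk lejk]; rewrite inE.
apply: (le_trans (y := JIrr_val k)) => //.
by rewrite def_a joins_sup.
Qed.

Lemma maxima_irr_below_decomposition a :
  join_decomposition a (maxima (irr_below a)).
Proof.
apply/le_anti/andP; split; last first.
  by apply/joinsP=> j; rewrite !inE => /andP[].
apply: le_join_irreducibles => j leja.
have /maxima_above[k maxk lejk] : j \in irr_below a by rewrite inE.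
apply: (le_trans (y := JIrr_val k)) => //.
exact: (joins_sup (@JIrr_val d L)).
Qed.

End FiniteLattice.

Theorem proposition3p9 (d : Order.disp_t) (L : finTBLatticeType d) (a : L) :
  exists! B : {set JIrr L}, maximal_antichain (join_decomposition a) B.
Proof.
have acM := maxima_antichain (irr_below a).
have decM := maxima_irr_below_decomposition a.
have leM C : join_decomposition a C -> trianglelefteq C (maxima (irr_below a)).
  by move=> decC; rewrite /trianglelefteq ideal_maxima_irr_below
    ideal_decomposition_sub.
(* Uniqueness: a maximal [B] is dominated by these maxima, so its own maximality makes the two
   equal. *)
exists (maxima (irr_below a)); split=> [|B [_ decB maxB]]; last first.
  by apply: maxB => //; apply: leM.
(* Maximality: a decomposition [C] dominating the maxima is also dominated by them, so the two
   ideals coincide. *)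
split=> // C acC decC leMC; apply: antichain_ideal_inj => //.
by apply/eqP; rewrite eqEsubset; apply/andP; split; first exact: leM.
Qed.
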